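(* Let $D=[0,\infty)\times[0,\infty)$, $n\in\mathbb{Z}$, $j\in\mathbb{N}$ with $j\ge1$, and let $u,v$ be nonzero complex parameters. Let $\widetilde w:D\to F^1$ be a continuous fuzzy-valued function with parametric form $(\underline w(x,y,\alpha),\overline w(x,y,\alpha))$, $\alpha\in[0,1]$. Suppose that $e^{-i(u^nx+v^ny)}\odot\widetilde w(x,y)$ and $e^{-i(u^nx+v^ny)}\odot\frac{\partial^j\widetilde w(x,y)}{\partial x^j}$ are improper fuzzy Riemann-integrable on $D$, and that for all $x>0$ there exist continuous partial H-derivatives of $\widetilde w$ with respect to $x$ up to order $j-1$ and there exists $\frac{\partial^j\widetilde w(x,y)}{\partial x^j}$. Then $$\widetilde D_{EE}\left\{\frac{\partial^j\widetilde w(x,y)}{\partial x^j}\right\}=(iu^n)^j\odot\widetilde D_{EE}\{w(x,y)\}-\sum_{k=0}^{j-1}(iu^n)^{j-k-1}\odot\widetilde E^c\left\{\frac{\partial^kw}{\partial x^k}(0,y)\right\}$$ in the following endpoint sense. For every $\alpha\in[0,1]$ put $$\underline T_j(\alpha)=(iu^n)^j\int_0^\infty\!\!\int_0^\infty e^{-i(u^nx+v^ny)}\underline w(x,y,\alpha)\,dx\,dy-\sum_{k=0}^{j-1}(iu^n)^{j-k-1}\int_0^\infty e^{-iv^ny}\,\frac{\partial^k\underline w}{\partial x^k}(0,y,\alpha)\,dy,$$ $$\overline T_j(\alpha)=(iu^n)^j\int_0^\infty\!\!\int_0^\infty e^{-i(u^nx+v^ny)}\overline w(x,y,\alpha)\,dx\,dy-\sum_{k=0}^{j-1}(iu^n)^{j-k-1}\int_0^\infty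 e^{-iv^ny}\,\frac{\partial^k\overline w}{\partial x^k}(0,y,\alpha)\,dy.$$ 1. If $\widetilde w$ is (i)-differentiable, then $\widetilde D_{EE}\left\{\frac{\partial^j\widetilde w(x,y)}{\partial x^j}\right\}=\big(\underline T_j(\alpha),\overline T_j(\alpha)\big)$ for all $\alpha\in[0,1]$. 2. If $\widetilde w$ is (ii)-differentiable, then $\widetilde D_{EE}\left\{\frac{\partial^j\widetilde w(x,y)}{\partial x^j}\right\}=\big(\overline T_j(\alpha),\underline T_j(\alpha)\big)$ for all $\alpha\in[0,1]$.
   Context: A fuzzy number is a function $\widetilde v:\mathbb{R}\to[0,1]$ that is upper semicontinuous, vanishes outside some interval $[c,d]$, is fuzzy convex, and for which there are $c\le a'\le b'\le d$ such that $\widetilde v$ is increasing on $[c,a']$, equals $1$ on $[a',b']$ and is decreasing on $[b',d]$. $F^1$ is the set of fuzzy numbers. Each $\widetilde v\in F^1$ is identified with its parametric form $(\underline v(\alpha),\overline v(\alpha))$, $\alpha\in[0,1]$, where $[\underline v(\alpha),\overline v(\alpha)]$ is the $\alpha$-level set: $\underline v$ is bounded, non-decreasing, left continuous on $(0,1]$ and right continuous at $0$; $\overline v$ is bounded, non-increasing, left continuous on $(0,1]$ and right continuous at $0$; and $\underline v(\alpha)\le\overline v(\alpha)$. Addition $\oplus$ and multiplication by positive scalars are endpointwise. Continuity and limits are with respect to $d(\widetilde v,\widetilde z)=\sup_{\alpha\in[0,1]}\max\{|\underline v(\alpha)-\underline z(\alpha)|,|\overline v(\alpha)-\overline z(\alpha)|\}$.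 H-derivatives: for fuzzy numbers, $\widetilde v\ominus\widetilde z$ is the fuzzy number $\widetilde c$ with $\widetilde v=\widetilde z\oplus\widetilde c$, if it exists. A fuzzy-valued function $\widetilde f$ is differentiable in $x$ at $(x_0,y)$ in the sense (i), with derivative $\frac{\partial\widetilde f}{\partial x}(x_0,y)\in F^1$, if for all sufficiently small $\tau>0$ the differences $\widetilde f(x_0+\tau,y)\ominus\widetilde f(x_0,y)$ and $\widetilde f(x_0,y)\ominus\widetilde f(x_0-\tau,y)$ exist and, multiplied by $\frac1\tau$, both tend to $\frac{\partial\widetilde f}{\partial x}(x_0,y)$ as $\tau\to0^+$; in the sense (ii), if the differences $\widetilde f(x_0,y)\ominus\widetilde f(x_0+\tau,y)$ and $\widetilde f(x_0-\tau,y)\ominus\widetilde f(x_0,y)$ exist and, multiplied by $\frac{-1}{\tau}$ (where a negative scalar interchanges the endpoints), both tend to $\frac{\partial\widetilde f}{\partial x}(x_0,y)$. Higher partial H-derivatives $\frac{\partial^\ell\widetilde w}{\partial x^\ell}$ are defined by iteration, each step being in the sense (i) or (ii). With respect to the $j$-th derivative, ''$\widetilde w$ is (i)-differentiable'' means that the number of steps taken in the sense (ii) is even, so that $\frac{\partial^j\widetilde w}{\partial x^j}$ has parametric form $\big(\frac{\partial^j\underline w}{\partial x^j},\frac{\partial^j\overline w}{\partial x^j}\big)$, and ''$\widetilde w$ is (ii)-differentiable'' means that this number is odd, so that $\frac{\partial^j\widetilde w}{\partial x^j}$ has parametric form $\big(\frac{\partial^j\overline w}{\partial x^j},\frac{\partial^j\underline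 w}{\partial x^j}\big)$. Derivatives at $x=0$ are one-sided. Transforms: for a fuzzy-valued $\widetilde f$ on $D$ with parametric form $(\underline f,\overline f)$, $$\widetilde D_{EE}\{f(x,y)\}=\left(\int_0^\infty\!\!\int_0^\infty e^{-i(u^nx+v^ny)}\underline f(x,y,\alpha)\,dx\,dy,\ \int_0^\infty\!\!\int_0^\infty e^{-i(u^nx+v^ny)}\overline f(x,y,\alpha)\,dx\,dy\right),\quad\alpha\in[0,1]$$ (a family of pairs of complex numbers); ''$e^{-i(u^nx+v^ny)}\odot\widetilde f$ is improper fuzzy Riemann-integrable on $D$'' means that these improper integrals converge for every $\alpha\in[0,1]$. $\widetilde E^c\{f(y)\}$ denotes the single complex EE transform $\int_0^\infty e^{-iv^ny}f(y)\,dy$, applied to the two endpoint functions.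
   Formalization: The single transforms of the endpoint derivatives of orders 1 ≤ k ≤ j−1 at x = 0, which occur in T_j, are assumed to converge; without this T_j can be undefined when the double integrals converge only conditionally. Convergence for k = 0 is proved. *)

(* Defs.v *)
From Stdlib Require Import Reals ZArith Arith.
From Coquelicot Require Import Coquelicot.
Open Scope R_scope.

(** * Fuzzy numbers *)

Definition upper_semicontinuous (f : R -> R) : Prop :=
  forall x eps, 0 < eps -> locally x (fun y => f y < f x + eps).

Definition fuzzy_convex (f : R -> R) : Prop :=
  forall x y t, 0 <= t <= 1 -> Rmin (f x) (f y) <= f (t * x + (1 - t) * y).

Record fuzzy : Type := Fuzzy {
  mem :> R -> R;
  mem_range : forall x, 0 <= mem x <= 1;
  mem_usc : upper_semicontinuous mem;
  mem_convex : fuzzy_convex mem;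
  mem_shape : exists c a' b' d, c <= a' <= b' /\ b' <= d /\
    (forall x, x < c \/ d < x -> mem x = 0) /\
    (forall x y, c <= x -> x <= y -> y <= a' -> mem x <= mem y) /\
    (forall x, a' <= x <= b' -> mem x = 1) /\
    (forall x y, b' <= x -> x <= y -> y <= d -> mem y <= mem x)
}.

(** For [alpha = 0] the level set is the closure of the support. *)
Definition level (v : fuzzy) (alpha : R) (x : R) : Prop :=
  (0 < alpha /\ alpha <= v x) \/
  (alpha = 0 /\ forall eps, 0 < eps -> exists z, Rabs (z - x) < eps /\ 0 < v z).

Definition lower (v : fuzzy) (alpha : R) : R := real (Glb_Rbar (level v alpha)).
Definition upper (v : fuzzy) (alpha : R) : R := real (Lub_Rbar (level v alpha)).

(** A parametric form is a map [alpha |-> (lower end, upper end)]; only its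
    values on [[0,1]] are ever used. *)
Definition pform : Type := R -> R * R.

Definition form (v : fuzzy) : pform := fun alpha => (lower v alpha, upper v alpha).

Definition padd (p q : pform) : pform :=
  fun alpha => (fst (p alpha) + fst (q alpha), snd (p alpha) + snd (q alpha)).

(** A negative scalar interchanges the endpoints. *)
Definition pscal (r : R) (p : pform) : pform :=
  fun alpha => if Rle_dec 0 r then (r * fst (p alpha), r * snd (p alpha))
               else (r * snd (p alpha), r * fst (p alpha)).

Definition pdist (p q : pform) : Rbar :=
  Lub_Rbar (fun r => exists alpha, 0 <= alpha <= 1 /\
    r = Rmax (Rabs (fst (p alpha) - fst (q alpha)))
             (Rabs (snd (p alpha) - snd (q alpha)))).

(** * H-derivatives *)

(** [c] is the H-difference of [v] and [z], i.e. [v = z + c]. *)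
Definition is_Hdiff (v z c : fuzzy) : Prop :=
  forall alpha, 0 <= alpha <= 1 -> form v alpha = padd (form z) (form c) alpha.

(** For all small [tau > 0] the H-difference of [p tau] and [q tau] exists and,
    multiplied by [r tau], it tends to [l] as [tau] tends to [0+]. *)
Definition Hquot_lim (r : R -> R) (p q : R -> fuzzy) (l : fuzzy) : Prop :=
  at_right 0 (fun tau => exists c, is_Hdiff (p tau) (q tau) c) /\
  forall eps : posreal, at_right 0 (fun tau => forall c,
    is_Hdiff (p tau) (q tau) c ->
    Rbar_lt (pdist (pscal (r tau) (form c)) (form l)) eps).

Inductive sense : Type := sense_i | sense_ii.

(** H-derivative, in the sense [s], at a point [x0] of the half-line [[0,oo)];
    one-sided at [x0 = 0]. *)
Definition is_Hderiv (s : sense) (f : R -> fuzzy) (x0 : R) (l : fuzzy) : Prop :=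
  match s with
  | sense_i =>
      Hquot_lim (fun tau => 1 / tau) (fun tau => f (x0 + tau)) (fun _ => f x0) l /\
      (0 < x0 ->
       Hquot_lim (fun tau => 1 / tau) (fun _ => f x0) (fun tau => f (x0 - tau)) l)
  | sense_ii =>
      Hquot_lim (fun tau => -1 / tau) (fun _ => f x0) (fun tau => f (x0 + tau)) l /\
      (0 < x0 ->
       Hquot_lim (fun tau => -1 / tau) (fun tau => f (x0 - tau)) (fun _ => f x0) l)
  end.

(** [dw k] is the [k]-th partial H-derivative of [w] in [x], the step from [k]
    to [k+1] being in the sense [s k].  Orders below [j] exist on
    [x >= 0] (at [x = 0] as one-sided derivatives), order [j] only on [x > 0]. *)
Definition is_Hderivs (s : nat -> sense) (j : nat)
    (w : R -> R -> fuzzy) (dw : nat -> R -> R -> fuzzy) : Prop :=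
  dw 0%nat = w /\
  forall k x y, (k < j)%nat -> 0 <= y -> (0 < x \/ (x = 0 /\ (S k < j)%nat)) ->
    is_Hderiv (s k) (fun t => dw k t y) x (dw (S k) x y).

Fixpoint nb_ii (s : nat -> sense) (j : nat) : nat :=
  match j with
  | O => O
  | S k => (match s k with sense_i => 0 | sense_ii => 1 end + nb_ii s k)%nat
  end.

(** (i)- and (ii)-differentiability with respect to the [j]-th derivative. *)
Definition i_differentiable (s : nat -> sense) (j : nat) : Prop := Nat.Even (nb_ii s j).
Definition ii_differentiable (s : nat -> sense) (j : nat) : Prop := Nat.Odd (nb_ii s j).

Definition in_D (x y : R) : Prop := 0 <= x /\ 0 <= y.

(** Continuity at a point, relative to [D = [0,oo) x [0,oo)]. *)
Definition fuzzy_continuous_at (f : R -> R -> fuzzy) (x0 y0 : R) : Prop :=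
  forall eps : posreal,
    within (fun q : R * R => in_D (fst q) (snd q)) (locally (x0, y0))
      (fun q => Rbar_lt (pdist (form (f (fst q) (snd q))) (form (f x0 y0))) eps).

(** * Derivatives of the (real) endpoint functions on [[0,oo)] *)

(** Two-sided for [x > 0], right derivative at [x = 0]. *)
Definition Dhalf (f : R -> R) (x : R) : R :=
  iota (fun l : R => filterlim (fun t => (f t - f x) / (t - x))
                       (within (fun t => 0 <= t) (locally' x)) (locally l)).

Fixpoint Dhalf_n (k : nat) (f : R -> R) : R -> R :=
  match k with
  | O => f
  | S k' => Dhalf (Dhalf_n k' f)
  end.

(** * Complex powers, exponential and improper integrals *)

Definition Czpow (z : C) (n : Z) : C :=
  match n with
  | Z0 => RtoC 1
  | Zpos p => Cpow z (Pos.to_nat p)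
  | Zneg p => Cinv (Cpow z (Pos.to_nat p))
  end.

Definition Cexp (z : C) : C := (exp (Re z) * cos (Im z), exp (Re z) * sin (Im z)).

(** Improper Riemann integral of a complex function over [(0,oo)].  It is also
    taken as improper at [0], since the [j]-th derivative need not be defined
    on the boundary; for functions integrable up to [0] this changes nothing. *)
Definition ex_CInt (f : R -> C) : Prop :=
  ex_RInt_gen (fun t => Re (f t)) (at_right 0) (Rbar_locally p_infty) /\
  ex_RInt_gen (fun t => Im (f t)) (at_right 0) (Rbar_locally p_infty).

Definition CInt (f : R -> C) : C :=
  (RInt_gen (fun t => Re (f t)) (at_right 0) (Rbar_locally p_infty),
   RInt_gen (fun t => Im (f t)) (at_right 0) (Rbar_locally p_infty)).

(** * Transforms *)

Definition kernel2 (n : Z) (u v : C) (x y : R) : C :=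
  Cexp (- (Ci * (Czpow u n * RtoC x + Czpow v n * RtoC y)))%C.

Definition kernel1 (n : Z) (v : C) (y : R) : C :=
  Cexp (- (Ci * (Czpow v n * RtoC y)))%C.

(** The double integral is the iterated one, [dx] inside and [dy] outside. *)
Definition EE2 (n : Z) (u v : C) (f : R -> R -> R) : C :=
  CInt (fun y => CInt (fun x => (kernel2 n u v x y * RtoC (f x y))%C)).

Definition ex_EE2 (n : Z) (u v : C) (f : R -> R -> R) : Prop :=
  (forall y, 0 < y -> ex_CInt (fun x => (kernel2 n u v x y * RtoC (f x y))%C)) /\
  ex_CInt (fun y => CInt (fun x => (kernel2 n u v x y * RtoC (f x y))%C)).

Definition EE1 (n : Z) (v : C) (f : R -> R) : C :=
  CInt (fun y => (kernel1 n v y * RtoC (f y))%C).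

Definition ex_EE1 (n : Z) (v : C) (f : R -> R) : Prop :=
  ex_CInt (fun y => (kernel1 n v y * RtoC (f y))%C).

Definition DEE (n : Z) (u v : C) (f : R -> R -> fuzzy) (alpha : R) : C * C :=
  (EE2 n u v (fun x y => lower (f x y) alpha),
   EE2 n u v (fun x y => upper (f x y) alpha)).

Definition fuzzy_integrable (n : Z) (u v : C) (f : R -> R -> fuzzy) : Prop :=
  forall alpha, 0 <= alpha <= 1 ->
    ex_EE2 n u v (fun x y => lower (f x y) alpha) /\
    ex_EE2 n u v (fun x y => upper (f x y) alpha).

(** [y |-> d^k g / dx^k (0, y)] for an endpoint function [g]. *)
Definition boundary (k : nat) (g : R -> R -> R) (y : R) : R :=
  Dhalf_n k (fun x => g x y) 0.

Definition boundary_transforms_exist (n : Z) (v : C) (k : nat)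
    (w : R -> R -> fuzzy) : Prop :=
  forall alpha, 0 <= alpha <= 1 ->
    ex_EE1 n v (boundary k (fun x y => lower (w x y) alpha)) /\
    ex_EE1 n v (boundary k (fun x y => upper (w x y) alpha)).

(** For [j >= 1], [sum_n a (j - 1)] is the sum of [a k] over [0 <= k <= j - 1]. *)
Definition T_endpoint (n : Z) (u v : C) (j : nat) (g : R -> R -> R) : C :=
  (Cpow (Ci * Czpow u n) j * EE2 n u v g
   - sum_n (fun k => Cpow (Ci * Czpow u n) (j - k - 1) * EE1 n v (boundary k g))
           (j - 1))%C.

Definition T_lower (n : Z) (u v : C) (j : nat) (w : R -> R -> fuzzy) (alpha : R) : C :=
  T_endpoint n u v j (fun x y => lower (w x y) alpha).
Definition T_upper (n : Z) (u v : C) (j : nat) (w : R -> R -> fuzzy) (alpha : R) : C :=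
  T_endpoint n u v j (fun x y => upper (w x y) alpha).

(* Main.v *)
Require Import Defs.
From Stdlib Require Import Reals ZArith Arith Lra Lia ClassicalEpsilon.
From Coquelicot Require Import Coquelicot.
Open Scope R_scope.

(** Fix [alpha] and an endpoint of [w]. A step of H-differentiation in sense (i)
    keeps the endpoint and one in sense (ii) exchanges lower and upper
    ([is_Hderiv_endpoint]), so the [k]-th derivative [g k] of the chosen endpoint
    function is an endpoint function of [dw k], the same one or the other
    according to the parity of the number of steps in sense (ii)
    ([side_parity]). This reduces everything to real functions.

    For fixed [y > 0] put [a = i u^n] and let [f k] be the kernel times [g k].
    Then [f k' = f (k+1) - a f k], so the boundary term
    [p = sum_(k <= j-1) a^(j-1-k) f k] of [j] integrations by parts has derivative
    [f j - a^j f 0]. Since the integrals of [f 0] and [f j] converge, [p] has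
    limits at [0+] and at infinity ([improper_FTC], which holds for merely
    integrable derivatives), and the integral of [f j] is [a^j] times that of
    [f 0] plus the difference of these limits.

    The limit at infinity is 0 although no growth condition on the derivatives
    is imposed ([combination_limit_zero]): convergence of the integral of [f 0]
    makes the unit increments of its antiderivative tend to 0, and passing to unit
    increments lowers the order of a combination of the [f k] that has a limit.
    The limit at [0+] is the sum of the [a^(j-1-k) f k(0)]; for [k = j-1], where
    continuity at 0 is not assumed, this uses that a limit of derivatives is a
    one-sided derivative ([inner_transform]).

    Integrating in [y] gives the formula ([endpoint_transform]). The boundary
    transform of order 0 converges because it is, up to the nonzero factor
    [a^(j-1)], a combination of convergent integrals. *)

(** * Improper integrals of derivatives *)

(** The fundamental theorem of calculus for a derivative that is integrable but
    perhaps discontinuous, as the one of order [j] may be. Tagging the uniform partitions with mean value points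
    makes every Riemann sum equal to [F b - F a]. *)
Lemma is_RInt_derivative (F f : R -> R) (a b I : R) :
  a < b -> (forall x, a <= x <= b -> is_derive F x (f x)) ->
  is_RInt f a b I -> I = F b - F a.
Proof.
  intros Hab HF HI.
  (* The tag must lie in [[c, d]] for every such interval, but can be a mean value
     point only inside [[a, b]]. *)
  assert (Htag : forall c d, exists t, (c <= d -> c <= t <= d) /\
      (a <= c -> c <= d -> d <= b -> F d - F c = f t * (d - c))).
  { intros c d.
    destruct (excluded_middle_informative (a <= c /\ c <= d /\ d <= b)) as [[Hc [Hcd Hd]]|Hn].
    - destruct (MVT_gen F c d f) as [t [Ht E]].
      + intros x Hx. rewrite Rmin_left, Rmax_right in Hx by lra. apply HF. lra.
      + intros x Hx. rewrite Rmin_left, Rmax_right in Hx by lra.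
        apply continuity_pt_filterlim, (ex_derive_continuous F). exists (f x). apply HF. lra.
      + rewrite Rmin_left, Rmax_right in Ht by lra. exists t. split; intros; assumption.
    - exists c. split; [lra|]. intros; exfalso; apply Hn; auto. }
  pose (tag c d := proj1_sig (constructive_indefinite_description _ (Htag c d))).
  assert (Ht1 : forall c d, c <= d -> c <= tag c d <= d).
  { intros c d. unfold tag. destruct constructive_indefinite_description as [t [H1 H2]]. exact H1. }
  assert (Ht2 : forall c d, a <= c -> c <= d -> d <= b -> F d - F c = f (tag c d) * (d - c)).
  { intros c d. unfold tag. destruct constructive_indefinite_description as [t [H1 H2]]. exact H2. }
  assert (Hsum : forall n c, a <= c <= b ->
     Riemann_sum f (SF_seq_f2 tag (unif_part c b n)) = F b - F c).
  { induction n as [|n IH]; intros c Hc.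
    - assert (E : unif_part c b 0 = (c :: b :: nil)%list).
      { unfold unif_part, seq.mkseq; simpl. f_equal; [field|]. f_equal. field. }
      rewrite E, SF_cons_f2 by (simpl; lia). rewrite Riemann_sum_cons. simpl.
      unfold Riemann_sum; simpl. unfold plus, zero, scal; simpl; unfold mult; simpl.
      rewrite (Ht2 c b) by lra. ring.
    - rewrite unif_part_S. set (d := (_ / _)).
      assert (Hd : c <= d <= b).
      { unfold d. rewrite !S_INR. pose proof (pos_INR n). split.
        - apply Rle_div_r; [lra|]. nra.
        - apply Rle_div_l; [lra|]. nra. }
      rewrite SF_cons_f2 by (unfold unif_part; rewrite seq.size_mkseq; lia).
      rewrite Riemann_sum_cons, IH by lra.
      rewrite head_unif_part. cbn [fst snd].
      replace (SF_h (SF_seq_f2 tag (unif_part d b n))) with d.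
      + unfold plus, scal; simpl; unfold mult; simpl. replace (F b - F c) with (F b - F d + (F d - F c)) by ring.
        rewrite (Ht2 c d) by lra. ring.
      + destruct (Riemann_fine_unif_part tag d b n Ht1 (proj2 Hd)) as [_ [_ [E _]]]. symmetry; exact E. }
  apply cond_eq. intros eps Heps.
  pose proof (proj1 (filterlim_locally _ _) HI (mkposreal eps Heps)) as HI'.
  destruct HI' as [del Hdel].
  destruct (seq_step_unif_part_ex a b del) as [n Hn].
  destruct (Riemann_fine_unif_part tag a b n Ht1 (Rlt_le _ _ Hab)) as [_ [H1 [H2 H3]]].
  specialize (Hdel (SF_seq_f2 tag (unif_part a b n))).
  rewrite SF_lx_f2 in Hdel by (unfold unif_part; rewrite seq.size_mkseq; lia).
  rewrite SF_lx_f2 in H3 by (unfold unif_part; rewrite seq.size_mkseq; lia).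
  rewrite Rmin_left, Rmax_right in Hdel by lra.
  specialize (Hdel Hn (conj H1 (conj H2 H3))).
  rewrite Hsum, sign_eq_1 in Hdel by lra.
  change (Rabs (1 * (F b - F a) - I) < eps) in Hdel.
  rewrite Rabs_minus_sym. rewrite Rmult_1_l in Hdel. exact Hdel.
Qed.


(** Convergence of the integral of [F'] forces [F] to have limits at both ends,
    by the Cauchy criterion. *)
Lemma improper_FTC (F f : R -> R) (l : R) :
  (forall x, 0 < x -> is_derive F x (f x)) ->
  is_RInt_gen f (at_right 0) (Rbar_locally p_infty) l ->
  exists l0 l1, filterlim F (at_right 0) (locally l0) /\
    filterlim F (Rbar_locally p_infty) (locally l1) /\ l = l1 - l0.
Proof.
  intros HF Hl.
  assert (Key : forall eps : posreal, exists P Q : R -> Prop,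
    at_right 0 P /\ Rbar_locally p_infty Q /\ (exists s, P s) /\ (exists t, Q t) /\
    forall s t, P s -> Q t -> Rabs (F t - F s - l) < eps).
  { intros eps.
    assert (Hb : locally l (fun z => Rabs (z - l) < eps)).
    { exists eps. intros z Hz. exact Hz. }
    destruct (Hl _ Hb) as [P Q HP HQ HPQ].
    exists (fun s => P s /\ 0 < s < 1), (fun t => Q t /\ 1 < t).
    assert (HP' : at_right 0 (fun s => P s /\ 0 < s < 1)).
    { apply filter_and; [exact HP|]. exists (mkposreal 1 Rlt_0_1). intros s Hs Hs0.
      change (Rabs (s - 0) < 1) in Hs. apply Rabs_lt_between in Hs. lra. }
    assert (HQ' : Rbar_locally p_infty (fun t => Q t /\ 1 < t)).
    { apply filter_and; [exact HQ|]. exists 1. auto. }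
    split; [exact HP'|]. split; [exact HQ'|].
    split; [exact (filter_ex _ HP')|]. split; [exact (filter_ex _ HQ')|].
    intros s t [Hs Hs1] [Ht Ht1].
    destruct (HPQ s t Hs Ht) as [I [HI HIl]]. cbn [fst snd] in HI.
    rewrite <- (is_RInt_derivative F f s t I); [exact HIl|lra| |exact HI].
    intros x Hx. apply HF. lra. }
  assert (H0 : exists l0, filterlim F (at_right 0) (locally l0)).
  { apply (proj1 (filterlim_locally_cauchy (U := R_CompleteSpace) F)). intros eps.
    destruct (Key (pos_div_2 eps)) as [P [Q [HP [_ [_ [[t Ht] H]]]]]].
    exists P. split; [exact HP|]. intros s s' Hs Hs'.
    change (Rabs (F s' - F s) < eps).
    pose proof (H s t Hs Ht) as H1. pose proof (H s' t Hs' Ht) as H2. simpl in H1, H2.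
    apply Rabs_lt_between in H1, H2. apply Rabs_lt_between. lra. }
  assert (H1 : exists l1, filterlim F (Rbar_locally p_infty) (locally l1)).
  { apply (proj1 (filterlim_locally_cauchy (U := R_CompleteSpace) F)). intros eps.
    destruct (Key (pos_div_2 eps)) as [P [Q [_ [HQ [[s Hs] [_ H]]]]]].
    exists Q. split; [exact HQ|]. intros t t' Ht Ht'.
    change (Rabs (F t' - F t) < eps).
    pose proof (H s t Hs Ht) as H1. pose proof (H s t' Hs Ht') as H2. simpl in H1, H2.
    apply Rabs_lt_between in H1, H2. apply Rabs_lt_between. lra. }
  destruct H0 as [l0 H0], H1 as [l1 H1]. exists l0, l1. repeat split; auto.
  apply cond_eq. intros eps Heps.
  assert (He : 0 < eps / 3) by lra.
  destruct (Key (mkposreal _ He)) as [P [Q [HP [HQ [_ [_ H]]]]]].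
  pose proof (proj1 (filterlim_locally _ _) H0 (mkposreal _ He)) as H0'.
  pose proof (proj1 (filterlim_locally _ _) H1 (mkposreal _ He)) as H1'.
  destruct (filter_ex _ (filter_and _ _ HP H0')) as [s [Hs Hs']].
  destruct (filter_ex _ (filter_and _ _ HQ H1')) as [t [Ht Ht']].
  change (Rabs (F s - l0) < eps / 3) in Hs'. change (Rabs (F t - l1) < eps / 3) in Ht'.
  pose proof (H s t Hs Ht) as Hst. simpl in Hst.
  apply Rabs_lt_between in Hs', Ht', Hst. apply Rabs_lt_between. lra.
Qed.

(** By the mean value theorem the increment is a value of [p] beyond [x]. *)
Lemma increment_limit (P p : R -> R) (L : R) :
  (forall x, 0 < x -> is_derive P x (p x)) ->
  filterlim p (Rbar_locally p_infty) (locally L) ->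
  filterlim (fun x => P (x + 1) - P x) (Rbar_locally p_infty) (locally L).
Proof.
  intros HP Hp. apply filterlim_locally. intros eps.
  destruct (proj1 (filterlim_locally _ _) Hp eps) as [M HM].
  exists (Rmax M 0). intros x Hx.
  assert (HxM : M < x /\ 0 < x) by (split; eapply Rle_lt_trans; [apply Rmax_l| |apply Rmax_r|]; eassumption).
  destruct (MVT_gen P x (x + 1) p) as [c [Hc E]].
  - intros t Ht. rewrite Rmin_left in Ht by lra. apply HP. lra.
  - intros t Ht. rewrite Rmin_left in Ht by lra.
    apply continuity_pt_filterlim, (ex_derive_continuous P). exists (p t). apply HP. lra.
  - rewrite Rmin_left in Hc by lra.
    rewrite E. replace (p c * (x + 1 - x)) with (p c) by ring. apply HM. lra.
Qed.

Lemma antiderivative_exists (f : R -> R) :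
  (forall x, 0 < x -> continuous f x) ->
  exists F : R -> R, forall x, 0 < x -> is_derive F x (f x).
Proof.
  intros Hf. exists (fun x => RInt f 1 x). intros x Hx.
  apply (is_derive_RInt f _ 1 x); [|apply Hf, Hx].
  exists (mkposreal x Hx). intros t Ht. change (Rabs (t - x) < x) in Ht.
  apply Rabs_lt_between in Ht.
  apply (RInt_correct f). apply (ex_RInt_continuous f). intros z Hz. apply Hf.
  assert (0 < Rmin 1 t) by (apply Rmin_pos; lra). lra.
Qed.

(** * Complex limits, derivatives and integrals, componentwise *)

(** All three notions are componentwise because [CInt] is, which makes the
    real theory (mean values, Riemann sums) directly applicable. *)
Definition is_Clim (F : (R -> Prop) -> Prop) (f : R -> C) (l : C) : Prop :=
  filterlim (fun x => Re (f x)) F (locally (Re l)) /\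
  filterlim (fun x => Im (f x)) F (locally (Im l)).

Definition is_Cderive (f : R -> C) (x : R) (l : C) : Prop :=
  is_derive (fun t => Re (f t)) x (Re l) /\ is_derive (fun t => Im (f t)) x (Im l).

Definition is_CInt (f : R -> C) (l : C) : Prop :=
  is_RInt_gen (fun t => Re (f t)) (at_right 0) (Rbar_locally p_infty) (Re l) /\
  is_RInt_gen (fun t => Im (f t)) (at_right 0) (Rbar_locally p_infty) (Im l).

Lemma CInt_correct f : ex_CInt f -> is_CInt f (CInt f).
Proof. intros [H1 H2]. split.
  - exact (RInt_gen_correct (V := R_CompleteNormedModule) _ H1).
  - exact (RInt_gen_correct (V := R_CompleteNormedModule) _ H2). Qed.

Lemma CInt_unique f l : is_CInt f l -> CInt f = l.
Proof.
  intros [H1 H2]. rewrite (surjective_pairing l). unfold CInt.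
  f_equal.
  - exact (is_RInt_gen_unique (V := R_CompleteNormedModule) _ _ H1).
  - exact (is_RInt_gen_unique (V := R_CompleteNormedModule) _ _ H2).
Qed.

Lemma is_CInt_ex f l : is_CInt f l -> ex_CInt f.
Proof. intros [H1 H2]. split; eexists; eassumption. Qed.

Lemma pos_interval_filter :
  filter_prod (at_right 0) (Rbar_locally p_infty)
    (fun ab => forall x, Rmin (fst ab) (snd ab) < x < Rmax (fst ab) (snd ab) -> 0 < x).
Proof.
  exists (fun s => 0 < s) (fun t => 0 < t).
  - exists (mkposreal 1 Rlt_0_1). auto.
  - exists 0. auto.
  - intros s t Hs Ht x [Hx _]. cbn [fst snd] in Hx. pose proof (Rmin_pos s t Hs Ht). lra.
Qed.

Lemma is_CInt_ext f g l : (forall x, 0 < x -> f x = g x) -> is_CInt f l -> is_CInt g l.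
Proof.
  intros E [H1 H2]; split; (eapply is_RInt_gen_ext; [|eassumption]);
    (eapply filter_imp; [|exact pos_interval_filter]);
    intros ab H x Hx; simpl; rewrite E by (apply H, Hx); reflexivity.
Qed.

Lemma is_CInt_plus f g lf lg :
  is_CInt f lf -> is_CInt g lg -> is_CInt (fun x => f x + g x)%C (lf + lg)%C.
Proof.
  intros [H1 H2] [H3 H4]; split.
  - exact (is_RInt_gen_plus _ _ _ _ H1 H3).
  - exact (is_RInt_gen_plus _ _ _ _ H2 H4).
Qed.

Lemma is_CInt_scal (c : C) f l : is_CInt f l -> is_CInt (fun x => c * f x)%C (c * l)%C.
Proof.
  intros [H1 H2]; split.
  - exact (is_RInt_gen_minus _ _ _ _ (is_RInt_gen_scal _ (Re c) _ H1) (is_RInt_gen_scal _ (Im c) _ H2)).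
  - exact (is_RInt_gen_plus _ _ _ _ (is_RInt_gen_scal _ (Re c) _ H2) (is_RInt_gen_scal _ (Im c) _ H1)).
Qed.

Lemma is_Cderive_plus f g x lf lg :
  is_Cderive f x lf -> is_Cderive g x lg -> is_Cderive (fun x => f x + g x)%C x (lf + lg)%C.
Proof.
  intros [H1 H2] [H3 H4]; split.
  - exact (is_derive_plus _ _ _ _ _ H1 H3).
  - exact (is_derive_plus _ _ _ _ _ H2 H4).
Qed.

Lemma is_Cderive_mult f g x lf lg :
  is_Cderive f x lf -> is_Cderive g x lg ->
  is_Cderive (fun x => f x * g x)%C x (lf * g x + f x * lg)%C.
Proof.
  intros [H1 H2] [H3 H4]; split; simpl.
  - match goal with |- is_derive _ _ ?l => replace l with (minus (plus (mult (Re lf) (Re (g x))) (mult (Re (f x)) (Re lg)))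
      (plus (mult (Im lf) (Im (g x))) (mult (Im (f x)) (Im lg)))) end.
    + refine (is_derive_minus _ _ _ _ _ (is_derive_mult _ _ _ _ _ H1 H3 _) (is_derive_mult _ _ _ _ _ H2 H4 _));
      intros; apply Rmult_comm.
    + unfold minus, plus, opp, mult, Re, Im; simpl; ring.
  - match goal with |- is_derive _ _ ?l => replace l with (plus (plus (mult (Re lf) (Im (g x))) (mult (Re (f x)) (Im lg)))
      (plus (mult (Im lf) (Re (g x))) (mult (Im (f x)) (Re lg)))) end.
    + refine (is_derive_plus _ _ _ _ _ (is_derive_mult _ _ _ _ _ H1 H4 _) (is_derive_mult _ _ _ _ _ H2 H3 _));
      intros; apply Rmult_comm.
    + unfold minus, plus, opp, mult, Re, Im; simpl; ring.
Qed.

Lemma is_Cderive_const c x : is_Cderive (fun _ => c) x 0%C.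
Proof.
  split; [exact (is_derive_const (V := R_NormedModule) (Re c) x)
         |exact (is_derive_const (V := R_NormedModule) (Im c) x)].
Qed.

Lemma is_Cderive_scal c f x l : is_Cderive f x l -> is_Cderive (fun x => c * f x)%C x (c * l)%C.
Proof.
  intros H. replace (c * l)%C with (0 * f x + c * l)%C by ring.
  exact (is_Cderive_mult _ _ _ _ _ (is_Cderive_const c x) H).
Qed.

Lemma filterlim_Rplus F {FF : Filter F} (f g : R -> R) lf lg :
  filterlim f F (locally lf) -> filterlim g F (locally lg) ->
  filterlim (fun x => f x + g x) F (locally (lf + lg)).
Proof.
  intros Hf Hg. apply (filterlim_comp_2 f g Rplus Hf Hg).
  exact (filterlim_plus (V := R_NormedModule) lf lg).
Qed.

Lemma filterlim_Rmult F {FF : Filter F} (f g : R -> R) lf lg :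
  filterlim f F (locally lf) -> filterlim g F (locally lg) ->
  filterlim (fun x => f x * g x) F (locally (lf * lg)).
Proof.
  intros Hf Hg. apply (filterlim_comp_2 f g Rmult Hf Hg).
  exact (filterlim_mult (K := R_AbsRing) lf lg).
Qed.

Lemma filterlim_Ropp F {FF : Filter F} (f : R -> R) lf :
  filterlim f F (locally lf) -> filterlim (fun x => - f x) F (locally (- lf)).
Proof.
  intros Hf. apply (filterlim_comp _ _ _ f Ropp _ _ _ Hf).
  exact (filterlim_opp (V := R_NormedModule) lf).
Qed.

Lemma is_Clim_plus F {FF : Filter F} f g lf lg :
  is_Clim F f lf -> is_Clim F g lg -> is_Clim F (fun x => f x + g x)%C (lf + lg)%C.
Proof. intros [H1 H2] [H3 H4]; split; apply (filterlim_Rplus F); assumption. Qed.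

Lemma is_Clim_mult F {FF : Filter F} f g lf lg :
  is_Clim F f lf -> is_Clim F g lg -> is_Clim F (fun x => f x * g x)%C (lf * lg)%C.
Proof.
  intros [H1 H2] [H3 H4]; split; apply (filterlim_Rplus F).
  - apply (filterlim_Rmult F); assumption.
  - apply (filterlim_Ropp F), (filterlim_Rmult F); assumption.
  - apply (filterlim_Rmult F); assumption.
  - apply (filterlim_Rmult F); assumption.
Qed.

Lemma is_Clim_const F {FF : Filter F} c : is_Clim F (fun _ => c) c.
Proof. split; apply filterlim_const. Qed.

Lemma is_Clim_scal F {FF : Filter F} (c : C) f l :
  is_Clim F f l -> is_Clim F (fun x => c * f x)%C (c * l)%C.
Proof. apply (is_Clim_mult F (fun _ => c)), is_Clim_const, FF. Qed.

Lemma is_Clim_ext F {FF : Filter F} f g l :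
  F (fun x => f x = g x) -> is_Clim F f l -> is_Clim F g l.
Proof.
  intros E [H1 H2]; split; (eapply filterlim_ext_loc; [|eassumption]);
    (eapply filter_imp; [|exact E]); intros x Hx; simpl; rewrite Hx; reflexivity.
Qed.

Lemma is_Clim_unique F {FF : ProperFilter F} f l l' : is_Clim F f l -> is_Clim F f l' -> l = l'.
Proof.
  intros [H1 H2] [H3 H4]. rewrite (surjective_pairing l), (surjective_pairing l').
  f_equal.
  - exact (filterlim_locally_unique (V := R_NormedModule) _ _ _ H1 H3).
  - exact (filterlim_locally_unique (V := R_NormedModule) _ _ _ H2 H4).
Qed.

(** * Finite sums of complex numbers *)

Lemma sum_n_first (c : nat -> C) (N : nat) :
  sum_n c (S N) = (c O + sum_n (fun k => c (S k)) N)%C.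
Proof.
  unfold sum_n. rewrite sum_Sn_m by lia. rewrite sum_n_m_S. reflexivity.
Qed.

Lemma sum_n_last (c : nat -> C) (N : nat) : sum_n c (S N) = (sum_n c N + c (S N))%C.
Proof. exact (sum_Sn (G := C_AbelianMonoid) c N). Qed.

Lemma sum_n_Cplus (c d : nat -> C) N :
  sum_n (fun k => c k + d k)%C N = (sum_n c N + sum_n d N)%C.
Proof. exact (sum_n_plus (G := C_AbelianMonoid) c d N). Qed.

Lemma sum_n_Cext (c d : nat -> C) N :
  (forall k, (k <= N)%nat -> c k = d k) -> sum_n c N = sum_n d N.
Proof. exact (sum_n_ext_loc (G := C_AbelianMonoid) c d N). Qed.

Lemma sum_n_Cscal (a : C) (c : nat -> C) N :
  (a * sum_n c N)%C = sum_n (fun k => a * c k)%C N.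
Proof.
  induction N as [|N IH]; [rewrite !sum_O; reflexivity|].
  rewrite !sum_n_last, <- IH. ring.
Qed.

Lemma is_CInt_sum_n (f : nat -> R -> C) (l : nat -> C) N :
  (forall k, (k <= N)%nat -> is_CInt (f k) (l k)) ->
  is_CInt (fun x => sum_n (fun k => f k x) N) (sum_n l N).
Proof.
  induction N as [|N IH]; intros H.
  - rewrite sum_O. apply (is_CInt_ext (f O)); [|apply H; lia].
    intros x _. rewrite sum_O. reflexivity.
  - rewrite sum_n_last.
    apply (is_CInt_ext (fun x => sum_n (fun k => f k x) N + f (S N) x)%C).
    + intros x _. rewrite sum_n_last. reflexivity.
    + apply is_CInt_plus; [apply IH; intros; apply H; lia|apply H; lia].
Qed.

Lemma is_Clim_sum_n F {FF : Filter F} (f : nat -> R -> C) (l : nat -> C) N :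
  (forall k, (k <= N)%nat -> is_Clim F (f k) (l k)) ->
  is_Clim F (fun x => sum_n (fun k => f k x) N) (sum_n l N).
Proof.
  induction N as [|N IH]; intros H.
  - rewrite sum_O. apply (is_Clim_ext F (f O)); [|apply H; lia].
    apply filter_forall. intros x. rewrite sum_O. reflexivity.
  - rewrite sum_n_last.
    apply (is_Clim_ext F (fun x => sum_n (fun k => f k x) N + f (S N) x)%C).
    + apply filter_forall. intros x. rewrite sum_n_last. reflexivity.
    + apply is_Clim_plus; [exact FF|apply IH; intros; apply H; lia|apply H; lia].
Qed.

Lemma is_Cderive_ext f g x l : (forall t, f t = g t) -> is_Cderive f x l -> is_Cderive g x l.
Proof.
  intros E [H1 H2]; split; (eapply is_derive_ext; [|eassumption]);
    intros t; simpl; rewrite E; reflexivity.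
Qed.

Lemma is_Cderive_sum_n (f : nat -> R -> C) (l : nat -> C) x N :
  (forall k, (k <= N)%nat -> is_Cderive (f k) x (l k)) ->
  is_Cderive (fun x => sum_n (fun k => f k x) N) x (sum_n l N).
Proof.
  induction N as [|N IH]; intros H.
  - rewrite sum_O. apply (is_Cderive_ext (f O)); [|apply H; lia].
    intros t. rewrite sum_O. reflexivity.
  - rewrite sum_n_last.
    apply (is_Cderive_ext (fun x => sum_n (fun k => f k x) N + f (S N) x)%C).
    + intros t. rewrite sum_n_last. reflexivity.
    + apply is_Cderive_plus; [apply IH; intros; apply H; lia|apply H; lia].
Qed.

(** * The boundary terms vanish at infinity *)

(** Division of the polynomial of coefficients [c] by [X - a], with quotient [q]
    and remainder [r] built as in Horner's scheme. The powers of the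
    indeterminate are replaced by arbitrary [X k], so that the identity can be
    applied to functions on which the shift [k -> k+1] acts as derivation + [a]. *)
Lemma division_by_X_minus (a : C) (N : nat) : forall c : nat -> C, exists (r : C) (q : nat -> C),
  forall X : nat -> C,
  (r * X O + sum_n (fun i => q i * (X (S i) - a * X i)) N)%C = sum_n (fun k => c k * X k)%C (S N).
Proof.
  induction N as [|N IH]; intros c.
  - exists (c O + a * c 1%nat)%C, (fun _ => c 1%nat). intros X.
    rewrite sum_n_last, !sum_O. ring.
  - destruct (IH (fun k => c (S k))) as [r [q H]].
    exists (c O + a * r)%C, (fun i => match i with O => r | S i' => q i' end). intros X.
    rewrite sum_n_first, (sum_n_first (fun k => c k * X k)%C).
    rewrite <- (H (fun k => X (S k))). ring.
Qed.

Lemma C_increment_limit (P p : R -> C) (L : C) :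
  (forall x, 0 < x -> is_Cderive P x (p x)) ->
  is_Clim (Rbar_locally p_infty) p L ->
  is_Clim (Rbar_locally p_infty) (fun x => P (x + 1)%R - P x)%C L.
Proof.
  intros HP [H1 H2]; split.
  - apply (increment_limit (fun x => Re (P x)) (fun x => Re (p x))); [apply HP|exact H1].
  - apply (increment_limit (fun x => Im (P x)) (fun x => Im (p x))); [apply HP|exact H2].
Qed.

Lemma is_Cderive_increment (f : R -> C) x l0 l1 :
  is_Cderive f x l0 -> is_Cderive f (x + 1) l1 ->
  is_Cderive (fun x => f (x + 1)%R - f x)%C x (l1 - l0)%C.
Proof.
  intros H0 H1.
  assert (Hs : is_Cderive (fun x => f (x + 1)%R) x l1).
  { assert (Hd : is_derive (fun x : R => x + 1) x 1) by (auto_derive; [trivial|ring]).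
    destruct H1 as [Ha Hb]; split.
    - pose proof (is_derive_comp _ _ _ _ _ Ha Hd) as H.
      rewrite <- (Rmult_1_l (Re l1)). exact H.
    - pose proof (is_derive_comp _ _ _ _ _ Hb Hd) as H.
      rewrite <- (Rmult_1_l (Im l1)). exact H. }
  pose proof (is_Cderive_plus _ _ _ _ _ Hs (is_Cderive_scal (-1)%C f x l0 H0)) as H.
  replace (l1 - l0)%C with (l1 + (-1) * l0)%C by ring.
  revert H. apply is_Cderive_ext. intros t. ring.
Qed.

Lemma is_Clim_shift (f : R -> C) l : is_Clim (Rbar_locally p_infty) f l ->
  is_Clim (Rbar_locally p_infty) (fun x => f (x + 1)%R) l.
Proof.
  assert (Hs : filterlim (fun x => x + 1) (Rbar_locally p_infty) (Rbar_locally p_infty)).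
  { intros P [M HM]. exists M. intros x Hx. apply HM. lra. }
  intros [H1 H2]; split;
    [exact (filterlim_comp _ _ _ _ _ _ _ _ Hs H1)|exact (filterlim_comp _ _ _ _ _ _ _ _ Hs H2)].
Qed.

(** The hypotheses say that [f k] is the [k]-th iterate of [D + a] applied to
    [f 0], where [D] is the derivation, and that the integral of [f 0] over
    [[x, x+1]] tends to 0. Dividing the combination by [X - a] gives it the
    antiderivative [r H + sum q_i f_i], whose increments over [[x, x+1]] then
    tend to [L]; so do those of [sum q_i f_i], since the increments of [H] tend
    to 0. The increments of the [f i] and of [H] again satisfy the hypotheses,
    with one term less. *)
Lemma combination_limit_zero (a : C) (N : nat) : forall (c : nat -> C) (f : nat -> R -> C) (H : R -> C) (L : C),
  (forall k x, (k < N)%nat -> 0 < x -> is_Cderive (f k) x (f (S k) x - a * f k x)%C) ->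
  (forall x, 0 < x -> is_Cderive H x (f O x)) ->
  is_Clim (Rbar_locally p_infty) (fun x => H (x + 1)%R - H x)%C 0%C ->
  is_Clim (Rbar_locally p_infty) (fun x => sum_n (fun k => c k * f k x)%C N) L ->
  L = 0%C.
Proof.
  induction N as [|N IH]; intros c f H L Hf HH HH0 HL.
  - apply (is_Clim_unique (Rbar_locally p_infty) (fun x => c O * (H (x + 1)%R - H x))%C).
    + apply (is_Clim_ext _ (fun x => c O * H (x + 1)%R - c O * H x)%C).
      * apply filter_forall. intros x. ring.
      * apply (C_increment_limit (fun x => c O * H x)%C (fun x => c O * f O x)%C).
        -- intros x Hx. apply is_Cderive_scal, HH, Hx.
        -- revert HL. apply is_Clim_ext; [typeclasses eauto|]. apply filter_forall.
           intros x. rewrite sum_O. reflexivity.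
    + replace (RtoC 0) with (c O * 0)%C by ring. apply is_Clim_scal; [typeclasses eauto|exact HH0].
  - destruct (division_by_X_minus a N c) as [r [q Hq]].
    pose (P x := (r * H x + sum_n (fun i => q i * f i x) N)%C).
    assert (HP : forall x, 0 < x -> is_Cderive P x (sum_n (fun k => c k * f k x)%C (S N))).
    { intros x Hx. rewrite <- (Hq (fun k => f k x)). apply is_Cderive_plus.
      - apply is_Cderive_scal, HH, Hx.
      - apply (is_Cderive_sum_n (fun i x => q i * f i x)%C).
        intros k Hk. apply is_Cderive_scal, Hf; [lia|exact Hx]. }
    pose proof (C_increment_limit P _ L HP HL) as HPL.
    apply (IH q (fun k x => f k (x + 1)%R - f k x)%C (fun x => H (x + 1)%R - H x)%C).
    + intros k x Hk Hx.
      replace (f (S k) (x + 1)%R - f (S k) x - a * (f k (x + 1)%R - f k x))%C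
        with ((f (S k) (x + 1)%R - a * f k (x + 1)%R) - (f (S k) x - a * f k x))%C by ring.
      apply is_Cderive_increment; apply Hf; lia || lra.
    + intros x Hx. apply is_Cderive_increment; apply HH; lra.
    + replace (RtoC 0) with (0 + (-1) * 0)%C by ring.
      apply (is_Clim_ext _ (fun x => (H (x + 1 + 1)%R - H (x + 1)%R) + (-1) * (H (x + 1)%R - H x))%C).
      { apply filter_forall. intros x. ring. }
      apply is_Clim_plus; [typeclasses eauto| |].
      * exact (is_Clim_shift _ _ HH0).
      * apply is_Clim_scal; [typeclasses eauto|exact HH0].
    + replace L with (L + (- r) * 0)%C by ring.
      apply (is_Clim_ext _ (fun x => (P (x + 1)%R - P x) + (- r) * (H (x + 1)%R - H x))%C).
      * apply filter_forall. intros x. unfold P.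
        transitivity (sum_n (fun k => q k * f k (x + 1)%R)%C N + (-1) * sum_n (fun k => q k * f k x)%C N)%C;
          [ring|].
        rewrite sum_n_Cscal, <- sum_n_Cplus. apply sum_n_Cext. intros k _. ring.
      * apply is_Clim_plus; [typeclasses eauto|exact HPL|].
        apply is_Clim_scal; [typeclasses eauto|exact HH0].
Qed.


Lemma C_improper_FTC (F f : R -> C) (l : C) :
  (forall x, 0 < x -> is_Cderive F x (f x)) -> is_CInt f l ->
  exists l0 l1, is_Clim (at_right 0) F l0 /\ is_Clim (Rbar_locally p_infty) F l1 /\
    l = (l1 - l0)%C.
Proof.
  intros HF [Hr Hi].
  destruct (improper_FTC (fun x => Re (F x)) (fun x => Re (f x)) (Re l)) as [r0 [r1 [H1 [H2 H3]]]];
    [apply HF|exact Hr|].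
  destruct (improper_FTC (fun x => Im (F x)) (fun x => Im (f x)) (Im l)) as [i0 [i1 [H4 [H5 H6]]]];
    [apply HF|exact Hi|].
  exists (r0, i0), (r1, i1). split; [split; assumption|]. split; [split; assumption|].
  rewrite (surjective_pairing l). unfold Re, Im in H3, H6. rewrite H3, H6. reflexivity.
Qed.

Lemma C_antiderivative_exists (f f' : R -> C) :
  (forall x, 0 < x -> is_Cderive f x (f' x)) ->
  exists F, forall x, 0 < x -> is_Cderive F x (f x).
Proof.
  intros Hf.
  destruct (antiderivative_exists (fun x => Re (f x))) as [Fr Hr].
  { intros x Hx. apply (ex_derive_continuous (fun x => Re (f x))).
    eexists. exact (proj1 (Hf x Hx)). }
  destruct (antiderivative_exists (fun x => Im (f x))) as [Fi Hi].
  { intros x Hx. apply (ex_derive_continuous (fun x => Im (f x))).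
    eexists. exact (proj2 (Hf x Hx)). }
  exists (fun x => (Fr x, Fi x)). intros x Hx. split; [apply Hr|apply Hi]; exact Hx.
Qed.

(** * Integrating an iterated derivative *)

Lemma telescoping (a : C) (X : nat -> C) (m : nat) :
  sum_n (fun k => Cpow a (m - k) * (X (S k) - a * X k))%C m
  = (X (S m) - Cpow a (S m) * X O)%C :> C.
Proof.
  induction m as [|m IH].
  - rewrite sum_O. simpl. ring.
  - rewrite sum_n_last.
    replace (sum_n (fun k => Cpow a (S m - k) * (X (S k) - a * X k))%C m)
      with (a * sum_n (fun k => Cpow a (m - k) * (X (S k) - a * X k))%C m)%C.
    + rewrite IH, Nat.sub_diag, (Cpow_S a (S m)). change (Cpow a 0) with (RtoC 1). ring.
    + rewrite sum_n_Cscal. apply sum_n_Cext. intros k Hk.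
      replace (S m - k)%nat with (S (m - k)) by lia. rewrite Cpow_S. ring.
Qed.

(** With [f k = e^(-ax) g^(k)], the sum in the conclusion is the boundary term
    of [m+1] integrations by parts: its derivative telescopes to
    [f (m+1) - a^(m+1) f 0]. Both integrals converge, so it has limits at [0+]
    and at infinity, and the latter is 0 by [combination_limit_zero]. *)
Lemma CInt_iterated_derivative (a : C) (m : nat) (f : nat -> R -> C) (l0 l : C) :
  (forall k x, (k <= m)%nat -> 0 < x -> is_Cderive (f k) x (f (S k) x - a * f k x)%C) ->
  is_CInt (f O) l0 -> is_CInt (f (S m)) l ->
  exists L0, is_Clim (at_right 0) (fun x => sum_n (fun k => Cpow a (m - k) * f k x)%C m) L0 /\
    l = (Cpow a (S m) * l0 - L0)%C.
Proof.
  intros Hf H0 Hm.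
  set (p := fun x => sum_n (fun k => Cpow a (m - k) * f k x)%C m).
  assert (Hp : forall x, 0 < x -> is_Cderive p x (f (S m) x - Cpow a (S m) * f O x)%C).
  { intros x Hx. rewrite <- (telescoping a (fun k => f k x)).
    apply (is_Cderive_sum_n (fun k x => Cpow a (m - k) * f k x)%C).
    intros k Hk. apply is_Cderive_scal, Hf; assumption. }
  destruct (C_improper_FTC p _ (l - Cpow a (S m) * l0)%C Hp) as [L0 [L1 [HL0 [HL1 E]]]].
  { replace (l - Cpow a (S m) * l0)%C with (l + (- Cpow a (S m)) * l0)%C by ring.
    apply (is_CInt_ext (fun x => f (S m) x + (- Cpow a (S m)) * f O x)%C).
    - intros x _. ring.
    - apply is_CInt_plus; [exact Hm|]. apply is_CInt_scal, H0. }
  destruct (C_antiderivative_exists (f O) (fun x => f 1%nat x - a * f O x)%C) as [H HH].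
  { intros x Hx. apply Hf; [lia|exact Hx]. }
  destruct (C_improper_FTC H _ l0 HH H0) as [h0 [h1 [_ [Hh1 _]]]].
  assert (HL : L1 = RtoC 0).
  { apply (combination_limit_zero a m (fun k => Cpow a (m - k)) f H).
    - intros k x Hk. apply Hf. lia.
    - exact HH.
    - replace (RtoC 0) with (h1 + (-1) * h1)%C by ring.
      apply (is_Clim_ext _ (fun x => H (x + 1)%R + (-1) * H x)%C).
      + apply filter_forall. intros x. ring.
      + apply is_Clim_plus; [typeclasses eauto|exact (is_Clim_shift _ _ Hh1)|].
        apply is_Clim_scal; [typeclasses eauto|exact Hh1].
    - exact HL1. }
  exists L0. split; [exact HL0|].
  replace l with ((l - Cpow a (S m) * l0) + Cpow a (S m) * l0)%C by ring.
  rewrite E, HL. ring.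
Qed.

(** * The exponential kernel *)

Lemma Cexp_linear_derive (U W : C) (x : R) :
  is_Cderive (fun t => Cexp (- (Ci * (U * RtoC t + W)))) x
    ((- (Ci * U)) * Cexp (- (Ci * (U * RtoC x + W))))%C.
Proof.
  destruct U as [p q], W as [r t]. unfold Cexp, Ci, RtoC. split; simpl;
    (auto_derive; [trivial|]; unfold Rminus; ring).
Qed.

Lemma Cexp_opp (z : C) : (Cexp (- z) * Cexp z)%C = RtoC 1.
Proof.
  destruct z as [x y]. unfold Cexp, Cmult, RtoC; simpl. rewrite cos_neg, sin_neg.
  pose proof (sin2_cos2 y) as H. unfold Rsqr in H.
  assert (E : exp (- x) * exp x = 1) by (rewrite <- exp_plus, Rplus_opp_l; apply exp_0).
  f_equal.
  - transitivity (exp (- x) * exp x * (sin y * sin y + cos y * cos y)); [ring|].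
    rewrite H, E. ring.
  - ring.
Qed.

Lemma is_Cderive_right_limit (f : R -> C) x l : is_Cderive f x l -> is_Clim (at_right x) f (f x).
Proof.
  intros [H1 H2]; split; (eapply filterlim_filter_le_1; [apply filter_le_within|]).
  - apply (ex_derive_continuous (fun t => Re (f t))). eexists; exact H1.
  - apply (ex_derive_continuous (fun t => Im (f t))). eexists; exact H2.
Qed.

(** * Derivatives on the half-line *)

(** The property by which [Dhalf] selects its value. *)
Definition is_Dhalf (f : R -> R) (x l : R) : Prop :=
  filterlim (fun t => (f t - f x) / (t - x)) (within (fun t => 0 <= t) (locally' x)) (locally l).

Lemma is_Dhalf_eps (f : R -> R) (x l : R) :
  is_Dhalf f x l <-> forall eps, 0 < eps -> exists del, 0 < del /\
    forall t, 0 <= t -> t <> x -> Rabs (t - x) < del -> Rabs ((f t - f x) / (t - x) - l) < eps.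
Proof.
  split.
  - intros H eps Heps. destruct (proj1 (filterlim_locally _ _) H (mkposreal eps Heps)) as [d Hd].
    exists d. split; [apply cond_pos|]. intros t Ht0 Htx Ht. exact (Hd t Ht Htx Ht0).
  - intros H. apply (filterlim_locally (U := R_UniformSpace)). intros eps.
    destruct (H eps (cond_pos eps)) as [d [Hd0 Hd]].
    exists (mkposreal d Hd0). intros t Ht Htx Ht0. exact (Hd t Ht0 Htx Ht).
Qed.

Lemma half_line_proper x : 0 <= x -> ProperFilter (within (fun t => 0 <= t) (locally' x)).
Proof.
  intros Hx. constructor; [|typeclasses eauto].
  intros P [d Hd]. exists (x + d / 2). pose proof (cond_pos d) as Hd0. apply Hd; [|lra|lra].
  change (Rabs (x + d / 2 - x) < d). rewrite Rabs_pos_eq; lra.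
Qed.

Lemma Dhalf_unique f x l : 0 <= x -> is_Dhalf f x l -> Dhalf f x = l.
Proof.
  intros Hx H. pose proof (half_line_proper x Hx) as HF.
  apply (iota_unique (V := R_CompleteNormedModule)); [|exact H].
  intros y Hy. exact (filterlim_locally_unique (V := R_NormedModule) _ _ _ Hy H).
Qed.

Lemma is_Dhalf_ext f g x l :
  (forall t, 0 <= t -> f t = g t) -> 0 <= x -> is_Dhalf f x l -> is_Dhalf g x l.
Proof.
  intros E Hx. apply filterlim_within_ext. intros t Ht. rewrite !E by assumption. reflexivity.
Qed.

Lemma is_Dhalf_is_derive f x l : 0 < x -> is_Dhalf f x l -> is_derive f x l.
Proof.
  intros Hx H. apply is_derive_Reals. intros eps Heps.
  destruct (proj1 (is_Dhalf_eps f x l) H eps Heps) as [d [Hd0 Hd]].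
  assert (Hm : 0 < Rmin d x) by (apply Rmin_pos; assumption).
  exists (mkposreal _ Hm). intros h Hh0 Hh. simpl in Hh.
  pose proof (Rmin_l d x). pose proof (Rmin_r d x).
  replace ((f (x + h) - f x) / h) with ((f (x + h) - f x) / (x + h - x))
    by (f_equal; ring).
  apply Hd.
  - apply Rabs_lt_between in Hh. lra.
  - lra.
  - replace (x + h - x) with h by ring. lra.
Qed.

Lemma is_Dhalf_right_limit f l : is_Dhalf f 0 l -> filterlim f (at_right 0) (locally (f 0)).
Proof.
  intros H. apply (filterlim_locally (U := R_UniformSpace)). intros eps.
  destruct (proj1 (is_Dhalf_eps f 0 l) H 1 Rlt_0_1) as [d [Hd0 Hd]].
  pose proof (Rabs_pos l) as Hl. pose proof (cond_pos eps) as Heps.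
  assert (Hm : 0 < Rmin d (eps / (Rabs l + 1))).
  { apply Rmin_pos; [exact Hd0|]. apply Rdiv_lt_0_compat; lra. }
  exists (mkposreal _ Hm). intros t Ht Ht0.
  change (Rabs (t - 0) < Rmin d (eps / (Rabs l + 1))) in Ht. change (Rabs (f t - f 0) < eps).
  pose proof (Rmin_l d (eps / (Rabs l + 1))). pose proof (Rmin_r d (eps / (Rabs l + 1))).
  specialize (Hd t (Rlt_le _ _ Ht0) (Rgt_not_eq _ _ Ht0) ltac:(lra)).
  rewrite Rminus_0_r in Hd, Ht. rewrite Rabs_pos_eq in Ht by lra.
  replace (f t - f 0) with ((f t - f 0) / t * t) by (field; lra).
  rewrite Rabs_mult, (Rabs_pos_eq t) by lra.
  assert (Hq : Rabs ((f t - f 0) / t) < Rabs l + 1).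
  { pose proof (Rabs_triang ((f t - f 0) / t - l) l) as Htr.
    replace ((f t - f 0) / t - l + l) with ((f t - f 0) / t) in Htr by ring. lra. }
  apply Rle_lt_trans with ((Rabs l + 1) * t).
  - apply Rmult_le_compat_r; lra.
  - rewrite Rmult_comm. apply (Rlt_div_r t eps); lra.
Qed.

(** Mean values on [[s, t]] with [0 < s], then [s] close to 0: on [[0, t]] the
    mean value theorem would require two-sided continuity at 0, and nothing is
    known to the left of 0. *)
Lemma derivative_limit_at_0 f f' l l' :
  is_Dhalf f 0 l -> (forall x, 0 < x -> is_derive f x (f' x)) ->
  filterlim f' (at_right 0) (locally l') -> l = l'.
Proof.
  intros H Hf Hl'. apply cond_eq. intros eps Heps.
  assert (He : 0 < eps / 4) by lra.
  destruct (proj1 (is_Dhalf_eps f 0 l) H _ He) as [d [Hd0 Hd]].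
  destruct (proj1 (filterlim_locally _ _) Hl' (mkposreal _ He)) as [d' Hd'].
  pose proof (cond_pos d') as Hd'0.
  set (t := Rmin d d' / 2).
  assert (Ht : 0 < t /\ t < d /\ t < d').
  { unfold t. pose proof (Rmin_pos d d' Hd0 Hd'0).
    pose proof (Rmin_l d d'). pose proof (Rmin_r d d'). lra. }
  specialize (Hd t ltac:(lra) ltac:(lra)).
  rewrite Rminus_0_r, (Rabs_pos_eq t) in Hd by lra. specialize (Hd ltac:(lra)).
  destruct (proj1 (filterlim_locally _ _) (is_Dhalf_right_limit f l H)
    (mkposreal (eps / 4 * t) (Rmult_lt_0_compat _ _ He (proj1 Ht)))) as [d'' Hd''].
  pose proof (cond_pos d'') as Hd''0.
  set (s := Rmin (eps * t / (4 * (Rabs l' + 1))) (Rmin d'' t) / 2).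
  pose proof (Rabs_pos l') as Hal.
  assert (Hs : 0 < s /\ s < d'' /\ s < t /\ Rabs l' * s < eps / 4 * t).
  { assert (Hq : 0 < eps * t / (4 * (Rabs l' + 1))).
    { apply Rdiv_lt_0_compat; [apply Rmult_lt_0_compat; lra|lra]. }
    assert (Hdt : 0 < Rmin d'' t) by (apply Rmin_pos; lra).
    pose proof (Rmin_pos _ _ Hq Hdt) as H1.
    pose proof (Rmin_l (eps * t / (4 * (Rabs l' + 1))) (Rmin d'' t)) as H2.
    pose proof (Rmin_r (eps * t / (4 * (Rabs l' + 1))) (Rmin d'' t)) as H3.
    pose proof (Rmin_l d'' t). pose proof (Rmin_r d'' t).
    assert (Hsq : s < eps * t / (4 * (Rabs l' + 1))) by (unfold s; lra).
    repeat split; try (unfold s; lra).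
    apply Rlt_div_r in Hsq; [|lra].
    assert (0 < s) by (unfold s; lra). nra. }
  specialize (Hd'' s).
  change (Rabs (s - 0) < d'' -> 0 < s -> Rabs (f s - f 0) < eps / 4 * t) in Hd''.
  rewrite Rminus_0_r, (Rabs_pos_eq s) in Hd'' by lra. specialize (Hd'' ltac:(lra) ltac:(lra)).
  destruct (MVT_gen f s t f') as [c [Hc E]].
  - intros x Hx. rewrite Rmin_left in Hx by lra. apply Hf. lra.
  - intros x Hx. rewrite Rmin_left in Hx by lra.
    apply continuity_pt_filterlim, (ex_derive_continuous f). exists (f' x). apply Hf. lra.
  - rewrite Rmin_left, Rmax_right in Hc by lra.
    specialize (Hd' c). change (Rabs (c - 0) < d' -> 0 < c -> Rabs (f' c - l') < eps / 4) in Hd'.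
    rewrite Rminus_0_r, (Rabs_pos_eq c) in Hd' by lra. specialize (Hd' ltac:(lra) ltac:(lra)).
    assert (H1 : Rabs (f t - f 0 - l * t) < eps / 4 * t).
    { replace (f t - f 0 - l * t) with (((f t - f 0) / t - l) * t) by (field; lra).
      rewrite Rabs_mult, (Rabs_pos_eq t) by lra. apply Rmult_lt_compat_r; lra. }
    assert (H2 : Rabs (f t - f s - l' * (t - s)) < eps / 4 * t).
    { rewrite E. replace (f' c * (t - s) - l' * (t - s)) with ((f' c - l') * (t - s)) by ring.
      rewrite Rabs_mult, (Rabs_pos_eq (t - s)) by lra.
      apply Rlt_le_trans with (eps / 4 * (t - s)); [apply Rmult_lt_compat_r; lra|].
      apply Rmult_le_compat_l; lra. }
    assert (H3 : Rabs (l' * s) < eps / 4 * t).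
    { rewrite Rabs_mult, (Rabs_pos_eq s) by lra. apply Hs. }
    assert (H4 : Rabs ((l - l') * t) < eps * t).
    { apply Rabs_lt_between in H1, H2, H3, Hd''. apply Rabs_lt_between. lra. }
    rewrite Rabs_mult, (Rabs_pos_eq t) in H4 by lra.
    apply Rmult_lt_reg_r in H4; lra.
Qed.


Lemma is_Clim_RtoC F (f : R -> R) l {FF : Filter F} :
  filterlim f F (locally l) -> is_Clim F (fun x => RtoC (f x)) (RtoC l).
Proof. intros H. split; [exact H|apply filterlim_const]. Qed.

Lemma kernel2_derive n u v x y :
  is_Cderive (fun t => kernel2 n u v t y) x (- (Ci * Czpow u n) * kernel2 n u v x y)%C.
Proof. apply Cexp_linear_derive. Qed.

Lemma kernel2_0 n u v y : kernel2 n u v 0 y = kernel1 n v y.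
Proof. unfold kernel2, kernel1. f_equal. ring. Qed.

Lemma kernel2_right_limit n u v y :
  is_Clim (at_right 0) (fun x => kernel2 n u v x y) (kernel1 n v y).
Proof.
  rewrite <- (kernel2_0 n u v).
  exact (is_Cderive_right_limit (fun x => kernel2 n u v x y) 0 _ (kernel2_derive n u v 0 y)).
Qed.

(** Multiply by the opposite exponential, which is continuous. *)
Lemma kernel2_factor_limit n u v y (h : R -> R) (M : C) :
  is_Clim (at_right 0) (fun x => kernel2 n u v x y * RtoC (h x))%C M ->
  exists l, filterlim h (at_right 0) (locally l).
Proof.
  intros HM.
  set (inv := fun x => Cexp (- (Ci * (- Czpow u n * RtoC x + - (Czpow v n * RtoC y))))%C).
  assert (Hinv : is_Clim (at_right 0) inv (inv 0)).
  { exact (is_Cderive_right_limit inv 0 _ (Cexp_linear_derive _ _ 0)). }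
  assert (H : is_Clim (at_right 0) (fun x => RtoC (h x)) (M * inv 0)%C).
  { apply (is_Clim_ext _ (fun x => kernel2 n u v x y * RtoC (h x) * inv x)%C).
    - apply filter_forall. intros x.
      transitivity (RtoC (h x) * (kernel2 n u v x y * inv x))%C; [ring|].
      unfold inv, kernel2.
      replace (- (Ci * (- Czpow u n * RtoC x + - (Czpow v n * RtoC y))))%C
        with (Ci * (Czpow u n * RtoC x + Czpow v n * RtoC y))%C by ring.
      rewrite Cexp_opp. ring.
    - apply is_Clim_mult; [typeclasses eauto|exact HM|exact Hinv]. }
  exists (Re (M * inv 0)%C). exact (proj1 H).
Qed.

(** * The transform of an iterated derivative of a real function *)

(** For [m > 0] the right limit of the [m]-th derivative at 0 exists because the
    whole boundary term and all its other summands have limits at [0+]; it is the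
    value at 0 because a limit of derivatives is a one-sided derivative. *)
Lemma inner_transform n u v m (g : nat -> R -> R) (y : R) :
  (forall k x, (k <= m)%nat -> 0 < x -> is_Dhalf (g k) x (g (S k) x)) ->
  (forall k, (k < m)%nat -> is_Dhalf (g k) 0 (g (S k) 0)) ->
  filterlim (g O) (at_right 0) (locally (g O 0)) ->
  ex_CInt (fun x => kernel2 n u v x y * RtoC (g O x))%C ->
  ex_CInt (fun x => kernel2 n u v x y * RtoC (g (S m) x))%C ->
  CInt (fun x => kernel2 n u v x y * RtoC (g (S m) x))%C =
  (Cpow (Ci * Czpow u n) (S m) * CInt (fun x => kernel2 n u v x y * RtoC (g O x))
   - sum_n (fun k => Cpow (Ci * Czpow u n) (m - k) * (kernel1 n v y * RtoC (g k 0%R))) m)%C.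
Proof.
  intros Hpos H0 Hg0 Hi0 Him.
  set (a := (Ci * Czpow u n)%C).
  set (f := fun k x => (kernel2 n u v x y * RtoC (g k x))%C).
  assert (Hf : forall k x, (k <= m)%nat -> 0 < x ->
    is_Cderive (f k) x (f (S k) x - a * f k x)%C).
  { intros k x Hk Hx.
    replace (f (S k) x - a * f k x)%C with
      (- a * kernel2 n u v x y * RtoC (g k x) + kernel2 n u v x y * RtoC (g (S k) x))%C
      by (unfold f; ring).
    apply (is_Cderive_mult (fun x => kernel2 n u v x y) (fun x => RtoC (g k x))).
    - apply kernel2_derive.
    - split; [exact (is_Dhalf_is_derive _ _ _ Hx (Hpos k x Hk Hx))|].
      exact (is_derive_const (V := R_NormedModule) 0 x). }
  destruct (CInt_iterated_derivative a m f _ _ Hf (CInt_correct _ Hi0) (CInt_correct _ Him))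
    as [L0 [HL0 E]].
  assert (Hlt : forall k, filterlim (g k) (at_right 0) (locally (g k 0)) ->
     is_Clim (at_right 0) (f k) (kernel1 n v y * RtoC (g k 0%R))%C).
  { intros k Hk. apply is_Clim_mult; [typeclasses eauto|apply kernel2_right_limit|].
    apply is_Clim_RtoC; [typeclasses eauto|exact Hk]. }
  assert (Hlim : forall k, (k <= m)%nat -> filterlim (g k) (at_right 0) (locally (g k 0))).
  { intros k Hk. destruct (le_lt_eq_dec k m Hk) as [Hkm|Hkm].
    { exact (is_Dhalf_right_limit _ _ (H0 k Hkm)). }
    subst k. destruct m as [|m']; [exact Hg0|].
    (* The last summand is the boundary term minus the lower ones. *)
    assert (HM : exists M, is_Clim (at_right 0) (f (S m')) M).
    { eexists. apply (is_Clim_ext _ (fun x =>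
        sum_n (fun k => Cpow a (S m' - k) * f k x) (S m')
        + (-1) * sum_n (fun k => Cpow a (S m' - k) * f k x) m')%C).
      - apply filter_forall. intros x. rewrite sum_n_last, Nat.sub_diag.
        change (Cpow a 0) with (RtoC 1). ring.
      - apply is_Clim_plus; [typeclasses eauto|exact HL0|].
        apply is_Clim_scal; [typeclasses eauto|].
        apply (is_Clim_sum_n _ (fun k x => Cpow a (S m' - k) * f k x)%C
          (fun k => Cpow a (S m' - k) * (kernel1 n v y * RtoC (g k 0%R)))%C).
        intros k Hk'. apply is_Clim_scal; [typeclasses eauto|].
        apply Hlt, (is_Dhalf_right_limit _ _ (H0 k ltac:(lia))). }
    destruct HM as [M HM]. destruct (kernel2_factor_limit n u v y (g (S m')) M HM) as [l Hl].
    rewrite (derivative_limit_at_0 (g m') (g (S m')) (g (S m') 0) l); [exact Hl| | |exact Hl].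
    - apply H0. lia.
    - intros x Hx. apply is_Dhalf_is_derive; [exact Hx|]. apply Hpos; [lia|exact Hx]. }
  change (CInt (f (S m)) = (Cpow a (S m) * CInt (f O)
   - sum_n (fun k => Cpow a (m - k) * (kernel1 n v y * RtoC (g k 0%R))) m)%C).
  unfold f at 1 2. rewrite E. f_equal.
  apply (is_Clim_unique (at_right 0) _ _ _ HL0).
  apply (is_Clim_sum_n _ (fun k x => Cpow a (m - k) * f k x)%C).
  intros k Hk. apply is_Clim_scal; [typeclasses eauto|]. apply Hlt, Hlim, Hk.
Qed.

Lemma Dhalf_n_iterate (m : nat) (g : nat -> R -> R) :
  (forall k x, (k < m)%nat -> 0 <= x -> is_Dhalf (g k) x (g (S k) x)) ->
  forall k x, (k <= m)%nat -> 0 <= x -> Dhalf_n k (g O) x = g k x.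
Proof.
  intros Hg. induction k as [|k IH]; intros x Hk Hx; [reflexivity|].
  apply Dhalf_unique; [exact Hx|].
  apply (is_Dhalf_ext (g k)); [|exact Hx|apply Hg; [lia|exact Hx]].
  intros t Ht. symmetry. apply IH; [lia|exact Ht].
Qed.

Lemma Czpow_nz z n : z <> RtoC 0 -> Czpow z n <> RtoC 0.
Proof.
  intros Hz. destruct n as [|p|p]; simpl.
  - exact C1_nz.
  - apply Cpow_nz, Hz.
  - intros E. apply C1_nz.
    rewrite <- (Cinv_r (Cpow z (Pos.to_nat p))) by apply Cpow_nz, Hz.
    rewrite E. ring.
Qed.

(** The identity of [inner_transform] is integrated in [y]. Solved for its term with [k = 0],
    whose coefficient is a power of the nonzero number [i u^n], it shows first
    that the boundary transform of order 0 converges. *)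
Lemma endpoint_transform n u v m (g : nat -> R -> R -> R) :
  u <> RtoC 0 ->
  (forall k x y, (k < S m)%nat -> 0 <= y -> (0 < x \/ (x = 0 /\ (S k < S m)%nat)) ->
     is_Dhalf (fun t => g k t y) x (g (S k) x y)) ->
  (forall y, 0 < y -> filterlim (fun x => g O x y) (at_right 0) (locally (g O 0 y))) ->
  ex_EE2 n u v (g O) -> ex_EE2 n u v (g (S m)) ->
  (forall k, (1 <= k <= m)%nat -> ex_EE1 n v (boundary k (g O))) ->
  ex_EE1 n v (boundary O (g O)) /\ EE2 n u v (g (S m)) = T_endpoint n u v (S m) (g O).
Proof.
  intros Hu Hd Hc [Hi0 Ho0] [Him Hom] HB.
  set (a := (Ci * Czpow u n)%C).
  assert (Ha : a <> RtoC 0).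
  { apply Cmult_neq_0; [|apply Czpow_nz, Hu]. intros E. injection E. lra. }
  set (B := fun k y => (kernel1 n v y * RtoC (boundary k (g O) y))%C).
  set (I0 := fun y => CInt (fun x => (kernel2 n u v x y * RtoC (g O x y))%C)).
  set (Im := fun y => CInt (fun x => (kernel2 n u v x y * RtoC (g (S m) x y))%C)).
  assert (Hin : forall y, 0 < y ->
    Im y = (Cpow a (S m) * I0 y - sum_n (fun k => Cpow a (m - k) * B k y) m)%C).
  { intros y Hy. unfold Im, I0.
    rewrite (inner_transform n u v m (fun k x => g k x y) y); auto.
    - f_equal. apply sum_n_Cext. intros k Hk. unfold B, boundary.
      rewrite (Dhalf_n_iterate m (fun k x => g k x y)); [reflexivity| |exact Hk|lra].
      intros i x Hi Hx. apply Hd; [lia|lra|]. destruct Hx as [Hx|Hx]; [left; exact Hx|right].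
      split; [symmetry; exact Hx|lia].
    - intros k x Hk Hx. apply Hd; [lia|lra|left; exact Hx].
    - intros k Hk. apply Hd; [lia|lra|right]. split; [reflexivity|lia]. }
  assert (HB0 : ex_CInt (B O)).
  (* The sum splits into its first term and an integrable rest, zero if [m = 0]. *)
  { assert (Hrest : exists r l, is_CInt r l /\ forall y,
      sum_n (fun k => Cpow a (m - k) * B k y)%C m = (Cpow a m * B O y + r y)%C :> C).
    { destruct m as [|m'].
      - exists (fun y => 0 * I0 y)%C. eexists. split.
        + apply is_CInt_scal, (CInt_correct _ Ho0).
        + intros y. rewrite sum_O, Nat.sub_diag. ring.
      - exists (fun y => sum_n (fun k => Cpow a (S m' - S k) * B (S k) y)%C m'). eexists. split.
        + apply (is_CInt_sum_n (fun k y => Cpow a (S m' - S k) * B (S k) y)%C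
            (fun k => Cpow a (S m' - S k) * CInt (B (S k)))%C).
          intros k Hk. apply is_CInt_scal, CInt_correct. apply HB. lia.
        + intros y. rewrite sum_n_first. rewrite Nat.sub_0_r. reflexivity. }
    destruct Hrest as [r [l [Hr Hs]]].
    eapply is_CInt_ex.
    apply (is_CInt_ext (fun y => / Cpow a m * ((Cpow a (S m) * I0 y + (-1) * Im y) + (-1) * r y))%C).
    - intros y Hy. rewrite (Hin y Hy), Hs. field. apply Cpow_nz, Ha.
    - apply is_CInt_scal. apply is_CInt_plus; [apply is_CInt_plus|].
      + apply is_CInt_scal, (CInt_correct _ Ho0).
      + apply is_CInt_scal, (CInt_correct _ Hom).
      + apply is_CInt_scal, Hr. }
  split; [exact HB0|].
  unfold T_endpoint, EE2. fold Im I0.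
  apply CInt_unique.
  replace (S m - 1)%nat with m by lia.
  apply (is_CInt_ext (fun y => Cpow a (S m) * I0 y + (-1) * sum_n (fun k => Cpow a (m - k) * B k y) m)%C).
  { intros y Hy. rewrite (Hin y Hy). ring. }
  match goal with |- is_CInt _ (?p - ?q)%C => replace (p - q)%C with (p + (-1) * q)%C by ring end.
  apply is_CInt_plus; [apply is_CInt_scal, (CInt_correct _ Ho0)|].
  apply is_CInt_scal.
  apply (is_CInt_sum_n (fun k y => Cpow a (m - k) * B k y)%C).
  intros k Hk. replace (S m - k - 1)%nat with (m - k)%nat by lia.
  apply is_CInt_scal, CInt_correct.
  destruct k as [|k]; [exact HB0|]. apply HB. lia.
Qed.

(** * Endpoint functions of fuzzy-valued functions *)

(** [true] stands for the upper and [false] for the lower endpoint, so that the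
    interchanges caused by sense (ii) become boolean negations. *)
Definition endpoint (b : bool) (v : fuzzy) (alpha : R) : R :=
  if b then upper v alpha else lower v alpha.

Lemma pdist_components (p q : pform) (eps alpha : R) :
  Rbar_lt (pdist p q) eps -> 0 <= alpha <= 1 ->
  Rabs (fst (p alpha) - fst (q alpha)) < eps /\ Rabs (snd (p alpha) - snd (q alpha)) < eps.
Proof.
  intros H Ha.
  set (M := Rmax (Rabs (fst (p alpha) - fst (q alpha))) (Rabs (snd (p alpha) - snd (q alpha)))).
  assert (HM : Rbar_le M (pdist p q)).
  { apply (proj1 (Lub_Rbar_correct _)). exists alpha. split; [exact Ha|reflexivity]. }
  assert (HM' : M < eps) by exact (Rbar_le_lt_trans _ _ _ HM H).
  split; (eapply Rle_lt_trans; [|exact HM']); [apply Rmax_l|apply Rmax_r].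
Qed.

(** For a negative scalar, an endpoint of the limit comes from the opposite
    endpoint of the differences. *)
Lemma Hquot_lim_endpoint (r : R -> R) (p q : R -> fuzzy) (l : fuzzy) (b : bool) (alpha : R) :
  Hquot_lim r p q l -> 0 <= alpha <= 1 -> forall eps, 0 < eps ->
  at_right 0 (fun tau =>
    let b' := if Rle_dec 0 (r tau) then b else negb b in
    Rabs (r tau * (endpoint b' (p tau) alpha - endpoint b' (q tau) alpha) - endpoint b l alpha) < eps).
Proof.
  intros [Hex Hlim] Ha eps Heps.
  generalize (filter_and _ _ Hex (Hlim (mkposreal eps Heps))). apply filter_imp.
  intros tau [[c Hc] H].
  destruct (pdist_components _ _ _ alpha (H c Hc) Ha) as [H1 H2].
  pose proof (Hc alpha Ha) as E. unfold form, padd in E. simpl in E. injection E as E1 E2.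
  unfold pscal, form in H1, H2. cbn zeta.
  destruct (Rle_dec 0 (r tau)); destruct b; simpl in *; rewrite ?E1, ?E2;
    match goal with |- Rabs (r tau * (?x + ?y - ?x) - _) < _ =>
      replace (x + y - x) with y by ring end; assumption.
Qed.

Lemma is_Dhalf_one_sided (g : R -> R) (x l : R) : 0 <= x ->
  (forall eps, 0 < eps -> at_right 0 (fun tau => Rabs ((g (x + tau) - g x) / tau - l) < eps)) ->
  (0 < x -> forall eps, 0 < eps ->
     at_right 0 (fun tau => Rabs ((g x - g (x - tau)) / tau - l) < eps)) ->
  is_Dhalf g x l.
Proof.
  intros Hx Hr Hl. apply is_Dhalf_eps. intros eps Heps.
  assert (Hl' : exists d, 0 < d /\ forall tau, 0 < tau < d -> tau <= x ->
    Rabs ((g x - g (x - tau)) / tau - l) < eps).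
  { destruct Hx as [Hx|Hx].
    - destruct (Hl Hx eps Heps) as [d Hd]. exists d. split; [apply cond_pos|].
      intros tau Ht _. apply Hd; [|lra]. change (Rabs (tau - 0) < d).
      rewrite Rminus_0_r, Rabs_pos_eq; lra.
    - exists 1. split; [lra|]. intros; lra. }
  destruct (Hr eps Heps) as [d1 Hd1]. destruct Hl' as [d2 [Hd20 Hd2]].
  pose proof (cond_pos d1) as Hd10.
  exists (Rmin d1 d2). split; [apply Rmin_pos; assumption|].
  intros t Ht0 Htx Ht. pose proof (Rmin_l d1 d2). pose proof (Rmin_r d1 d2).
  apply Rabs_lt_between in Ht.
  destruct (Rlt_le_dec x t) as [H1|H1].
  - replace t with (x + (t - x)) at 1 by ring. apply Hd1; [|lra].
    change (Rabs (t - x - 0) < d1). rewrite Rminus_0_r, Rabs_pos_eq; lra.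
  - replace ((g t - g x) / (t - x)) with ((g x - g (x - (x - t))) / (x - t)).
    + apply Hd2; lra.
    + replace (x - (x - t)) with t by ring. field. lra.
Qed.

Definition flip (s : sense) (b : bool) : bool :=
  match s with sense_i => b | sense_ii => negb b end.

(** In sense (ii) the reversed difference and the scalar [-1/tau] restore the
    usual difference quotient, but with the endpoints interchanged. *)
Lemma is_Hderiv_endpoint (s : sense) (f : R -> fuzzy) (x : R) (l : fuzzy) (b : bool) (alpha : R) :
  0 <= x -> 0 <= alpha <= 1 -> is_Hderiv s f x l ->
  is_Dhalf (fun t => endpoint b (f t) alpha) x (endpoint (flip s b) l alpha).
Proof.
  intros Hx Ha H.
  assert (Hpos : at_right 0 (fun tau => 0 < tau)).
  { exists (mkposreal 1 Rlt_0_1). auto. }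
  assert (Hs : forall tau, 0 < tau -> 0 < 1 / tau).
  { intros tau Ht. apply Rdiv_lt_0_compat; lra. }
  assert (Hn : forall tau, 0 < tau -> ~ 0 <= -1 / tau).
  { intros tau Ht. specialize (Hs tau Ht).
    replace (-1 / tau) with (- (1 / tau)) by (field; lra). lra. }
  destruct s; destruct H as [Hr Hl].
  - assert (Hq : forall p q, Hquot_lim (fun tau => 1 / tau) p q l -> forall eps, 0 < eps ->
      at_right 0 (fun tau => Rabs ((endpoint b (p tau) alpha - endpoint b (q tau) alpha) / tau
                                   - endpoint b l alpha) < eps)).
    { intros p q H eps Heps.
      generalize (filter_and _ _ Hpos (Hquot_lim_endpoint _ _ _ _ b alpha H Ha eps Heps)).
      apply filter_imp. intros tau [Ht Hq]. cbn zeta in Hq.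
      destruct (Rle_dec 0 (1 / tau)) as [_|N]; [|pose proof (Hs tau Ht); lra].
      match goal with |- Rabs (?d / tau - _) < _ =>
        replace (d / tau) with (1 / tau * d) by (field; lra) end.
      exact Hq. }
    apply is_Dhalf_one_sided; [exact Hx|exact (Hq _ _ Hr)|].
    intros Hx0. exact (Hq _ _ (Hl Hx0)).
  - assert (Hq : forall p q, Hquot_lim (fun tau => -1 / tau) p q l -> forall eps, 0 < eps ->
      at_right 0 (fun tau => Rabs ((endpoint b (q tau) alpha - endpoint b (p tau) alpha) / tau
                                   - endpoint (negb b) l alpha) < eps)).
    { intros p q H eps Heps.
      generalize (filter_and _ _ Hpos (Hquot_lim_endpoint _ _ _ _ (negb b) alpha H Ha eps Heps)).
      apply filter_imp. intros tau [Ht Hq]. cbn zeta in Hq.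
      destruct (Rle_dec 0 (-1 / tau)) as [N|_]; [destruct (Hn tau Ht N)|].
      rewrite Bool.negb_involutive in Hq.
      match goal with |- Rabs ((?c - ?d) / tau - _) < _ =>
        replace ((c - d) / tau) with (-1 / tau * (d - c)) by (field; lra) end.
      exact Hq. }
    apply is_Dhalf_one_sided; [exact Hx|exact (Hq _ _ Hr)|].
    intros Hx0. exact (Hq _ _ (Hl Hx0)).
Qed.

Lemma fuzzy_continuous_endpoint (f : R -> R -> fuzzy) (y : R) (b : bool) (alpha : R) :
  0 <= y -> 0 <= alpha <= 1 -> fuzzy_continuous_at f 0 y ->
  filterlim (fun x => endpoint b (f x y) alpha) (at_right 0) (locally (endpoint b (f 0 y) alpha)).
Proof.
  intros Hy Ha H. apply (filterlim_locally (U := R_UniformSpace)). intros eps.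
  destruct (H eps) as [d Hd]. exists d. intros x Hx Hx0.
  destruct (pdist_components _ _ _ alpha
    (Hd (x, y) (conj Hx (ball_center y d)) (conj (Rlt_le _ _ Hx0) Hy)) Ha) as [H1 H2].
  destruct b; [exact H2|exact H1].
Qed.

(** The endpoint of [dw k] that is the [k]-th derivative of the endpoint [b] of
    [w]. *)
Fixpoint side (s : nat -> sense) (b : bool) (k : nat) : bool :=
  match k with O => b | S k' => flip (s k') (side s b k') end.

Lemma side_parity s b j : side s b j = xorb b (Nat.odd (nb_ii s j)).
Proof.
  induction j as [|j IH]; simpl; [destruct b; reflexivity|].
  rewrite IH. destruct (s j); simpl.
  - reflexivity.
  - rewrite Nat.odd_succ, <- Nat.negb_odd. destruct b, (Nat.odd (nb_ii s j)); reflexivity.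
Qed.

Lemma fuzzy_endpoint_transform n j u v w s dw b alpha :
  (1 <= j)%nat -> u <> RtoC 0 ->
  (forall x y, in_D x y -> fuzzy_continuous_at w x y) ->
  is_Hderivs s j w dw ->
  fuzzy_integrable n u v w -> fuzzy_integrable n u v (dw j) ->
  (forall k, (1 <= k <= j - 1)%nat -> boundary_transforms_exist n v k w) ->
  0 <= alpha <= 1 ->
  ex_EE1 n v (boundary O (fun x y => endpoint b (w x y) alpha)) /\
  EE2 n u v (fun x y => endpoint (side s b j) (dw j x y) alpha) =
    T_endpoint n u v j (fun x y => endpoint b (w x y) alpha).
Proof.
  intros Hj Hu Hcont [Hw Hder] Hi0 Hij HB Ha. subst w.
  destruct j as [|m]; [lia|].
  apply (endpoint_transform n u v m (fun k x y => endpoint (side s b k) (dw k x y) alpha)).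
  - exact Hu.
  - intros k x y Hk Hy Hx. apply (is_Hderiv_endpoint (s k) (fun t => dw k t y)); [|exact Ha|].
    + destruct Hx as [Hx|[Hx _]]; lra.
    + apply Hder; assumption.
  - intros y Hy. apply (fuzzy_continuous_endpoint (dw O)); [lra|exact Ha|].
    apply Hcont. split; lra.
  - destruct (Hi0 alpha Ha) as [H1 H2]. destruct b; assumption.
  - destruct (Hij alpha Ha) as [H1 H2]. destruct (side s b (S m)); assumption.
  - intros k Hk. destruct (HB k ltac:(lia) alpha Ha) as [H1 H2]. destruct b; assumption.
Qed.

(** * The transform of the [j]-th H-derivative *)

Theorem mainTheorem2 :
  forall (n : Z) (j : nat) (u v : C) (w : R -> R -> fuzzy)
         (s : nat -> sense) (dw : nat -> R -> R -> fuzzy),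
  (1 <= j)%nat ->
  u <> RtoC 0 -> v <> RtoC 0 ->
  (forall x y, in_D x y -> fuzzy_continuous_at w x y) ->
  is_Hderivs s j w dw ->
  (forall k x y, (k <= j - 1)%nat -> 0 < x -> 0 <= y ->
     fuzzy_continuous_at (dw k) x y) ->
  fuzzy_integrable n u v w ->
  fuzzy_integrable n u v (dw j) ->
  (* The single transforms of orders 1 <= k <= j - 1 occurring in T_j converge;
     this does not follow from conditional convergence of the double integrals.
     The transform of order 0 is not assumed to converge. *)
  (forall k, (1 <= k <= j - 1)%nat -> boundary_transforms_exist n v k w) ->
  (forall k, (k <= j - 1)%nat -> boundary_transforms_exist n v k w) /\
  (i_differentiable s j ->
     forall alpha, 0 <= alpha <= 1 ->
     DEE n u v (dw j) alpha = (T_lower n u v j w alpha, T_upper n u v j w alpha)) /\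
  (ii_differentiable s j ->
     forall alpha, 0 <= alpha <= 1 ->
     DEE n u v (dw j) alpha = (T_upper n u v j w alpha, T_lower n u v j w alpha)).
Proof.
  intros n j u v w s dw Hj Hu _ Hcont Hder _ Hi0 Hij HB.
  assert (Key : forall b alpha, 0 <= alpha <= 1 ->
    ex_EE1 n v (boundary O (fun x y => endpoint b (w x y) alpha)) /\
    EE2 n u v (fun x y => endpoint (side s b j) (dw j x y) alpha) =
      T_endpoint n u v j (fun x y => endpoint b (w x y) alpha)).
  { intros b alpha Ha. eapply fuzzy_endpoint_transform; eassumption. }
  split; [|split].
  - intros [|k] Hk.
    + intros alpha Ha.
      exact (conj (proj1 (Key false alpha Ha)) (proj1 (Key true alpha Ha))).
    + apply HB. lia.
  - intros He alpha Ha. apply Nat.even_spec in He.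
    destruct (Key false alpha Ha) as [_ E1]. destruct (Key true alpha Ha) as [_ E2].
    rewrite side_parity, <- Nat.negb_even, He in E1, E2.
    exact (f_equal2 pair E1 E2).
  - intros Ho alpha Ha. apply Nat.odd_spec in Ho.
    destruct (Key false alpha Ha) as [_ E1]. destruct (Key true alpha Ha) as [_ E2].
    rewrite side_parity, Ho in E1, E2.
    exact (f_equal2 pair E2 E1).
Qed.
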